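(* Let $p(z)= z^{\ell} + b_{\ell-1} z^{\ell-1} + \dots + b_{1} z + b_{0}$ be a polynomial with complex coefficients, $\ell \geq 3$, with zeros $\{z_{j}\}_{j=1}^{\ell}$. Define $m = \lceil \ell/2 \rceil$, $n=2m$, and complex numbers $a_0,\dots,a_{n-1}$ by: if $\ell$ is even, $a_{j} = b_{j}$ for $j=0,\dots,n-1$; if $\ell$ is odd, $a_{0} = 0$ and $a_{j} = b_{j-1}$ for $j=1,\dots,n-1$. Define $$A_{0} = \begin{pmatrix} -a_0 & a_{n-1} a_0 \\ -a_1 & a_{n-1} a_1 - a_0 \end{pmatrix}, \qquad A_{j} = \begin{pmatrix} -a_{2j} & a_{n-1} a_{2j} -a_{2j-1} \\ -a_{2j+1} & a_{n-1}a_{2j+1} -a_{2j} \end{pmatrix} \quad (j=1,\dots,m-1),$$ and let $S$ be a nonsingular complex $2\times 2$ matrix such that $S^{-1}A_{m-1} S = \begin{pmatrix} \alpha & \gamma \\ 0 & \beta \end{pmatrix}$, where $\alpha, \beta, \gamma \in \mathbb{C}$. Define the vectors $v=(v_0,\dots,v_{n-3})$, $w=(w_0,\dots,w_{n-3}) \in \mathbb{C}^{n-2}$ by $$\begin{pmatrix} v_{2j} & w_{2j} \\ v_{2j+1} & w_{2j+1} \end{pmatrix} = S^{-1} A_j S \quad (j=0,\dots,m-2).$$ Then the following holds for every $j \in \{1,\dots,\ell\}$. (a) $|z_{j}| \leq \max \{ r_{1} , r_{2} \}$, where $r_{1}$ and $r_{2}$ are the unique positive solutions of $\psi_{1}(x)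 = 0$ and $\psi_{2}(x) = 0$, respectively, with $$\psi_{1}(x) = x^{n} - |\alpha|x^{n-2} - |v_{n-3}|x^{n-3} - \dots - |v_1| x - |v_0|,$$ $$\psi_{2}(x) = x^{n+1} - |\beta|x^{n-1} - |\gamma| x^{n-2} - |w_{n-3}|x^{n-3} - \dots - |w_1| x - |w_0|.$$ (b) $|z_{j}| \leq \bigl( \max \{ s_{1} , s_{2} \} \bigr)^{1/2}$, where $s_{1}$ and $s_{2}$ are the unique positive solutions of $\varphi_{1}(x) = 0$ and $\varphi_{2}(x) = 0$, respectively, with $$\varphi_{1}(x) = x^{m} - |\alpha|x^{m-1} - \bigl( |v_{n-3}| + |v_{n-4}| \bigr) x^{m-2} - \dots - \bigl( |v_{3}| + |v_2| \bigr) x - \bigl( |v_1| + |v_0| \bigr),$$ $$\varphi_{2}(x) = x^{m} - (|\beta|+|\gamma|)x^{m-1} - \bigl( |w_{n-3}| + |w_{n-4}| \bigr) x^{m-2} - \dots - \bigl( |w_{3}| + |w_2| \bigr) x - \bigl( |w_1| + |w_0| \bigr).$$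
   Context: In $\psi_1,\psi_2$ the coefficient of $x^{k}$ for $0\le k\le n-3$ is $-|v_k|$, respectively $-|w_k|$. In $\varphi_1,\varphi_2$ the coefficient of $x^{k}$ for $0 \le k \le m-2$ is $-(|v_{2k+1}|+|v_{2k}|)$, respectively $-(|w_{2k+1}|+|w_{2k}|)$.
   Formalization: When one of ψ₁, ψ₂, φ₁, φ₂ is a bare power of x (e.g. for p(z)=z^ℓ) it has no positive solution; in that case the corresponding r_i or s_i is taken to be 0, and the bounds are proved with that convention. *)

(* Defs.v *)
From HB Require Import structures.
From mathcomp Require Import all_boot all_order all_algebra.
From mathcomp Require Import reals.
From mathcomp Require Import complex.

Set Implicit Arguments.
Unset Strict Implicit.
Unset Printing Implicit Defensive.

Import Order.TTheory GRing.Theory Num.Theory.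
Local Open Scope ring_scope.

(* The modulus with values in R; `|z| itself lives in R[i]. *)
Notation cmod := ComplexField.Normc.normc.

Section Defs.
Variable R : realType.
Implicit Types (b a v w : nat -> R[i]) (f : {poly R}).

Definition mx2 (x11 x12 x21 x22 : R[i]) : 'M[R[i]]_2 :=
  \matrix_(i, j) nth 0 (nth [::] [:: [:: x11; x12]; [:: x21; x22]] i) j.

(* uphalf l = ceil (l / 2). *)
Definition half_deg (l : nat) : nat := uphalf l.
Definition even_deg (l : nat) : nat := (half_deg l).*2.

(* Meaningful for j < even_deg l. *)
Definition a_coef (l : nat) b (j : nat) : R[i] :=
  if odd l then (if j is j'.+1 then b j' else 0) else b j.

Definition A_block (n : nat) a (j : nat) : 'M[R[i]]_2 :=
  if j is 0%N then
    mx2 (- a 0%N) (a n.-1 * a 0%N)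
        (- a 1%N) (a n.-1 * a 1%N - a 0%N)
  else
    mx2 (- a j.*2)   (a n.-1 * a j.*2 - a j.*2.-1)
        (- a j.*2.+1) (a n.-1 * a j.*2.+1 - a j.*2).

Definition psi1 (n : nat) (alpha : R[i]) v : {poly R} :=
  'X^n - cmod alpha *: 'X^(n - 2)
  - \sum_(k < n - 2) cmod (v k) *: 'X^k.

Definition psi2 (n : nat) (beta gamma : R[i]) w : {poly R} :=
  'X^(n + 1) - cmod beta *: 'X^(n - 1) - cmod gamma *: 'X^(n - 2)
  - \sum_(k < n - 2) cmod (w k) *: 'X^k.

Definition phi1 (m : nat) (alpha : R[i]) v : {poly R} :=
  'X^m - cmod alpha *: 'X^(m - 1)
  - \sum_(k < m - 1) (cmod (v k.*2.+1) + cmod (v k.*2)) *: 'X^k.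

Definition phi2 (m : nat) (beta gamma : R[i]) w : {poly R} :=
  'X^m - (cmod beta + cmod gamma) *: 'X^(m - 1)
  - \sum_(k < m - 1) (cmod (w k.*2.+1) + cmod (w k.*2)) *: 'X^k.

(* A monic f whose other coefficients are all nonpositive has a positive root
   unless f is a bare power of 'X; in that degenerate case the only
   nonnegative root, 0, is taken instead. *)
Definition pos_sol f (r : R) : Prop :=
  if f == 'X^((size f).-1) then r = 0 else 0 < r /\ f.[r] = 0.

End Defs.

(* Main.v *)
Require Import Defs.
From HB Require Import structures.
From mathcomp Require Import all_boot all_order all_algebra.
From mathcomp Require Import reals.
From mathcomp Require Import complex.
From mathcomp Require Import ring.

Set Implicit Arguments.
Unset Strict Implicit.
Unset Printing Implicit Defensive.

Import Order.TTheory GRing.Theory Num.Theory.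
Local Open Scope ring_scope.

(* For a zero x of p, the row vector (1, x) satisfies
   (1, x) sum_j x^(2j) A_j = x^n (1, x), so u = (1, x) S satisfies the same
   relation with the blocks S^-1 A_j S. Taking moduli in its two coordinates and
   bounding the smaller of |u_1|, |u_2| by the larger gives phi_1(|x|^2) <= 0 or
   phi_2(|x|^2) <= 0; comparing |u_2| with |x| |u_1| instead gives
   psi_1(|x|) <= 0 or psi_2(|x|) <= 0. All four are Cauchy polynomials, which
   are positive to the right of their positive root. *)

Lemma big_ord_double (V : nmodType) (F : nat -> V) p :
  \sum_(k < p.*2) F k = \sum_(j < p) (F j.*2 + F j.*2.+1).
Proof.
elim: p => [|p IHp]; first by rewrite !big_ord0.
by rewrite doubleS !big_ord_recr /= IHp addrA.
Qed.

(** * Cauchy polynomials ['X^N - g], with [g] of smaller degree and nonnegative coefficients *)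

Lemma ge0_horner_scale (R : realFieldType) (g : {poly R}) N (x t : R) :
  (forall k, 0 <= g`_k) -> (size g <= N.+1)%N -> 0 <= x -> 1 <= t ->
  g.[t * x] <= t ^+ N * g.[x].
Proof.
move=> g_ge0 gN x_ge0 t_ge1; rewrite !(horner_coef_wide _ gN) mulr_sumr.
apply: ler_sum => k _; rewrite exprMn mulrCA ler_wpM2r//.
  by rewrite mulr_ge0 ?exprn_ge0.
by rewrite ler_weXn2l// -ltnS.
Qed.

(** Passing from [r] to a larger [x = t * r] multiplies [g] by at most [t ^+ N.-1] but the leading
    power by [t ^+ N], so [g] cannot catch up. *)
Lemma cauchy_root_bound (R : realFieldType) (g : {poly R}) N (r x : R) :
  (forall k, 0 <= g`_k) -> (size g <= N)%N -> 0 < r -> g.[r] = r ^+ N ->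
  x ^+ N <= g.[x] -> x <= r.
Proof.
case: N => [|N] g_ge0 gN r_gt0 gr gx.
  have g0 : g = 0 by apply/eqP; rewrite -size_poly_leq0.
  by move/esym/eqP: gr; rewrite g0 horner0 expr0 oner_eq0.
rewrite leNgt; apply/negP => rx.
have t_gt1 : 1 < x / r by rewrite ltr_pdivlMr// mul1r.
have := ge0_horner_scale g_ge0 gN (ltW r_gt0) (ltW t_gt1).
rewrite divfK ?gt_eqF// gr => /(le_trans gx).
rewrite -[X in X ^+ _ <= _](@divfK _ r) ?gt_eqF// exprMn ler_pM2r ?exprn_gt0//.
by rewrite leNgt ltr_eXn2l// ltnSn.
Qed.

Lemma cauchy_root_exists (R : rcfType) (g : {poly R}) N :
  (forall k, 0 <= g`_k) -> (size g <= N)%N -> g != 0 ->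
  exists2 r, 0 < r & g.[r] = r ^+ N.
Proof.
move=> g_ge0 gN g_neq0.
have sg : (0 < size g)%N by rewrite lt0n size_poly_eq0.
case: N gN => [|N] gN; first by move: sg; rewrite ltnNge gN.
(* Left end for the intermediate value theorem: since [x <= 1] and [x <= c], the leading term of [g]
   alone is at least the higher power [x ^+ N.+1]. *)
set c := lead_coef g; set x := Num.min 1 c.
have c_gt0 : 0 < c by rewrite lt_def lead_coef_eq0 g_neq0 g_ge0.
have x_gt0 : 0 < x by rewrite lt_min ltr01.
have x_le1 : x <= 1 by rewrite ge_min lexx.
have x_lec : x <= c by rewrite ge_min lexx orbT.
have gx : x ^+ N.+1 <= g.[x].
  rewrite horner_coef; have kg : ((size g).-1 < size g)%N by rewrite prednK.
  rewrite (bigD1 (Ordinal kg))//= -/(lead_coef g) -/c.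
  apply: (@le_trans _ _ (c * x ^+ (size g).-1)).
    have -> : N.+1 = ((N - (size g).-1).+1 + (size g).-1)%N.
      by rewrite addSn subnK// -ltnS prednK.
    rewrite exprD ler_wpM2r ?exprn_ge0 ?(ltW x_gt0)//.
    apply: le_trans x_lec; rewrite exprS ler_piMr ?(ltW x_gt0)//.
    by rewrite exprn_ile1 ?(ltW x_gt0).
  by rewrite lerDl sumr_ge0// => i _; rewrite mulr_ge0 ?exprn_ge0 ?(ltW x_gt0).
(* Right end: scaling from 1 gives [g.[B] <= B ^+ N * g.[1]], and [g.[1] <= B]. *)
set B := 1 + g.[1].
have g1_ge0 : 0 <= g.[1].
  by rewrite horner_coef sumr_ge0// => i _; rewrite expr1n mulr1.
have B_ge1 : 1 <= B by rewrite lerDl.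
have gB : g.[B] <= B ^+ N.+1.
  have := ge0_horner_scale g_ge0 gN ler01 B_ge1.
  rewrite mulr1 => /le_trans; apply; rewrite exprSr ler_wpM2l ?lerDr//.
  by rewrite exprn_ge0// (le_trans ler01).
have [||r /andP[xr _] /rootP fr] := @poly_ivt R ('X^(N.+1) - g) x B.
- exact: le_trans x_le1 B_ge1.
- by rewrite !hornerE subr_le0 gx subr_ge0.
exists r; first exact: lt_le_trans xr.
by move/eqP: fr; rewrite !hornerE subr_eq0 => /eqP.
Qed.

Lemma unique_pos_sol (R : realType) (g : {poly R}) N :
  (forall k, 0 <= g`_k) -> (size g <= N)%N -> (0 < N)%N ->
  exists r, [/\ unique (pos_sol ('X^N - g)) r, 0 <= r &
    forall x, 0 <= x -> x ^+ N <= g.[x] -> x <= r].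
Proof.
move=> g_ge0 gN N_gt0.
have sf : size ('X^N - g) = N.+1 by rewrite size_polyDl ?size_polyN size_polyXn.
(* The degenerate test in [pos_sol] becomes [g == 0]; there the solution is 0 by convention and
   [x ^+ N <= 0] forces [x = 0]. *)
rewrite /pos_sol sf /= -subr_eq0 addrAC subrr add0r oppr_eq0.
have [->|g_neq0] := eqVneq g 0.
  exists 0; split=> [|//|x x_ge0]; first by split=> // y ->.
  rewrite horner0 => xN.
  have : x ^+ N == 0 by rewrite eq_le xN exprn_ge0.
  by rewrite expf_eq0 N_gt0 => /eqP->.
have [r r_gt0 gr] := cauchy_root_exists g_ge0 gN g_neq0.
exists r; split; [split| |] => [|y [y_gt0]||x x_ge0].
- by rewrite r_gt0 !hornerE gr subrr.
(* Of two positive roots, each bounds the other. *)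
- move=> /eqP; rewrite !hornerE subr_eq0 => /eqP gy; apply/le_anti/andP; split.
    by apply: (cauchy_root_bound g_ge0 gN y_gt0) => //; rewrite gr.
  by apply: (cauchy_root_bound g_ge0 gN r_gt0) => //; rewrite gy.
- exact: ltW.
- exact: cauchy_root_bound.
Qed.

(** * The real-valued modulus *)

Lemma cmod_ge0 (R : rcfType) (x : R[i]) : 0 <= cmod x.
Proof. by case: x => a b; rewrite sqrtr_ge0. Qed.

Lemma cmodX (R : rcfType) (x : R[i]) n : cmod (x ^+ n) = cmod x ^+ n.
Proof.
elim: n => [|n IHn]; first by rewrite !expr0 ComplexField.Normc.normc1.
by rewrite !exprS ComplexField.Normc.normcM IHn.
Qed.

Lemma cmod_sum (R : rcfType) n (F : nat -> R[i]) :
  cmod (\sum_(j < n) F j) <= \sum_(j < n) cmod (F j).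
Proof.
elim: n => [|n IHn]; first by rewrite !big_ord0 ComplexField.Normc.normc0.
by rewrite !big_ord_recr /= (le_trans (le_normcD _ _))// lerD2r.
Qed.

(** * The block relation at a zero *)

Lemma mul_row_mx2 (R : realType) (u : 'rV[R[i]]_2) x11 x12 x21 x22 :
  (u *m mx2 x11 x12 x21 x22) 0 0 = u 0 0 * x11 + u 0 1 * x21 /\
  (u *m mx2 x11 x12 x21 x22) 0 1 = u 0 0 * x12 + u 0 1 * x22.
Proof.
by rewrite !mxE !big_ord_recl !big_ord0 !mxE /= !addr0 (_ : lift ord0 ord0 = 1) //; apply: val_inj.
Qed.

(** For odd [l] the shifted coefficients are those of the polynomial times its variable, which keeps
    every zero. *)
Lemma a_coef_root (R : realType) l (b : nat -> R[i]) x :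
  (0 < l)%N -> x ^+ l + \sum_(j < l) b j * x ^+ j = 0 ->
  x ^+ even_deg l + \sum_(k < even_deg l) a_coef l b k * x ^+ k = 0.
Proof.
rewrite /even_deg /half_deg /a_coef => l_gt0 px; have [lodd|leven] := boolP (odd l); last first.
  by rewrite even_uphalfK.
rewrite odd_uphalfK// big_ord_recl mul0r add0r exprS.
transitivity (x * (x ^+ l + \sum_(j < l) b j * x ^+ j)); last by rewrite px mulr0.
rewrite mulrDr mulr_sumr; congr (_ + _).
by apply: eq_bigr => j _; rewrite exprS mulrCA.
Qed.

(* The blocks A_j form the last two columns of the square of the companion
   matrix, which has (1, x, ..., x^(n-1)) as left eigenvector for x^2. *)
Lemma A_block_eigen (R : realType) (a : nat -> R[i]) m x :
  (0 < m)%N -> x ^+ m.*2 + \sum_(k < m.*2) a k * x ^+ k = 0 ->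
  let y := \row_(k < 2) x ^+ k in
  \sum_(j < m) x ^+ j.*2 *: (y *m A_block m.*2 a j) = x ^+ m.*2 *: y.
Proof.
case: m => // p _; set n := p.+1.*2 => pa y.
(* Reading the coefficient of index -1 as 0 puts [A_block] at 0 in the same form as the other
   blocks. *)
pose a' k := if k is k'.+1 then a k' else 0.
have Ablock j : A_block n a j = mx2 (- a j.*2) (a n.-1 * a j.*2 - a' j.*2)
    (- a j.*2.+1) (a n.-1 * a j.*2.+1 - a' j.*2.+1).
  by case: j => [|j] //=; rewrite subr0.
have {}pa : \sum_(k < n) a k * x ^+ k = - x ^+ n.
  by apply/eqP; rewrite -addr_eq0 addrC pa.
have pa' : \sum_(k < n) a' k * x ^+ k = - x ^+ n.+1 - a n.-1 * x ^+ n.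
  rewrite /n doubleS big_ord_recl mul0r add0r.
  move: pa; rewrite /n doubleS big_ord_recr /= => /(canRL (addrK _)) pa.
  under eq_bigr => k _ do rewrite /bump /= exprS mulrCA.
  by rewrite -mulr_sumr pa !exprS; ring.
have yE k : y 0 k = x ^+ k by rewrite mxE.
apply/rowP => k; rewrite summxE mxE yE.
under eq_bigr => j _ do rewrite mxE Ablock.
have [->|->] : k = 0 \/ k = 1.
  by case: k => [[|[|//]]] ?; [left|right]; apply: val_inj.
  under eq_bigr => j _ do rewrite (mul_row_mx2 _ _ _ _ _).1 !yE.
  rewrite expr0 mulr1 -[RHS]opprK -pa (big_ord_double (fun k => a k * x ^+ k)) -sumrN.
  by apply: eq_bigr => j _; rewrite /= exprS; ring.
under eq_bigr => j _ do rewrite (mul_row_mx2 _ _ _ _ _).2 !yE.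
(* By [pa] and [pa'] the terms in [a n.-1 * x ^+ n] cancel and [x ^+ n.+1] remains. *)
transitivity (a n.-1 * (\sum_(k < n) a k * x ^+ k) - \sum_(k < n) a' k * x ^+ k).
  rewrite (big_ord_double (fun k => a k * x ^+ k)).
  rewrite (big_ord_double (fun k => a' k * x ^+ k)) mulr_sumr -sumrB.
  by apply: eq_bigr => j _; rewrite /= !exprS; ring.
by rewrite pa pa' /= exprSr; ring.
Qed.

(** * Moduli, roots and coordinates in the form the theorem uses *)

Lemma cmod_block_bound (R : rcfType) (x u u1 u2 d : R[i]) (c : nat -> R[i]) p :
  u * x ^+ p.*2.+2 =
    d * x ^+ p.*2 + \sum_(j < p) x ^+ j.*2 * (u1 * c j.*2 + u2 * c j.*2.+1) ->
  cmod u * cmod x ^+ p.*2.+2 <= cmod d * cmod x ^+ p.*2 +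
    \sum_(j < p) cmod x ^+ j.*2 *
      (cmod u1 * cmod (c j.*2) + cmod u2 * cmod (c j.*2.+1)).
Proof.
move=> eq_u; rewrite -cmodX -ComplexField.Normc.normcM eq_u.
rewrite (le_trans (le_normcD _ _))// ComplexField.Normc.normcM cmodX lerD2l.
pose F j := x ^+ j.*2 * (u1 * c j.*2 + u2 * c j.*2.+1).
apply: le_trans (cmod_sum p F) _; apply: ler_sum => j _.
rewrite ComplexField.Normc.normcM cmodX ler_wpM2l ?exprn_ge0 ?cmod_ge0//.
by rewrite (le_trans (le_normcD _ _))// !ComplexField.Normc.normcM.
Qed.

(** One shape for all four polynomials: [psi2] uses both separate terms, the other three take
    [d2 = 0]. *)
Lemma cauchy_sol (R : realType) N (d1 d2 : R) e1 e2 (c : nat -> R) q :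
  0 <= d1 -> 0 <= d2 -> (forall k, 0 <= c k) ->
  (e1 < N)%N -> (e2 < N)%N -> (q <= N)%N ->
  exists r, [/\ unique (pos_sol ('X^N - d1 *: 'X^e1 - d2 *: 'X^e2
                                 - \sum_(k < q) c k *: 'X^k)) r, 0 <= r &
    forall x, 0 <= x ->
      x ^+ N <= d1 * x ^+ e1 + d2 * x ^+ e2 + \sum_(k < q) c k * x ^+ k -> x <= r].
Proof.
move=> d1_ge0 d2_ge0 c_ge0 e1N e2N qN.
set s := \sum_(k < q) _; pose g := d1 *: 'X^e1 + d2 *: 'X^e2 + s.
have -> : 'X^N - d1 *: 'X^e1 - d2 *: 'X^e2 - s = 'X^N - g by rewrite !opprD !addrA.
have g_ge0 k : 0 <= g`_k.
  rewrite /g /s -poly_def !coefD !coefZ !coefXn coef_poly.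
  by rewrite !addr_ge0 ?mulr_ge0 ?ler0n//; case: ifP.
have gN : (size g <= N)%N.
  rewrite /g /s -poly_def; apply/leq_sizeP => k Nk.
  rewrite !coefD !coefZ !coefXn coef_poly ltnNge (leq_trans qN Nk)//=.
  by rewrite !gtn_eqF ?(leq_trans _ Nk)// !mulr0 !addr0.
have [r [r_uniq r_ge0 r_max]] := unique_pos_sol g_ge0 gN (leq_ltn_trans (leq0n _) e1N).
exists r; split=> // x x_ge0 xN; apply: r_max => //.
rewrite /g !hornerE horner_sum.
by under [X in _ <= _ + X]eq_bigr => k _ do rewrite hornerZ hornerXn.
Qed.

(** The witnesses are the coordinates of [(1, x) S], nonzero because [S] is invertible. The zero
    entry of the triangular block keeps [u2] out of the leading term of the first equation. *)
Lemma block_coords (R : realType) (l : nat) (b : nat -> R[i]) x p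
    (S : 'M[R[i]]_2) (alpha beta gamma : R[i]) (v w : nat -> R[i]) :
  (0 < l)%N -> half_deg l = p.+1 ->
  x ^+ l + \sum_(j < l) b j * x ^+ j = 0 -> S \in unitmx ->
  let A := A_block (even_deg l) (a_coef l b) in
  invmx S *m A p *m S = mx2 alpha gamma 0 beta ->
  (forall j, (j < p)%N ->
     mx2 (v j.*2) (w j.*2) (v j.*2.+1) (w j.*2.+1) = invmx S *m A j *m S) ->
  exists u1 u2 : R[i],
  [/\ ~~ ((u1 == 0) && (u2 == 0)),
     u1 * x ^+ p.*2.+2 = (u1 * alpha) * x ^+ p.*2 +
       \sum_(j < p) x ^+ j.*2 * (u1 * v j.*2 + u2 * v j.*2.+1)
   & u2 * x ^+ p.*2.+2 = (u1 * gamma + u2 * beta) * x ^+ p.*2 +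
       \sum_(j < p) x ^+ j.*2 * (u1 * w j.*2 + u2 * w j.*2.+1)].
Proof.
move=> l_gt0 mE px Su A Ap Aj.
have := a_coef_root l_gt0 px; rewrite /even_deg mE => /(A_block_eigen (ltn0Sn p)).
rewrite /A /even_deg mE in Ap Aj.
set y := \row_k _; set B := A_block _ _ in Ap Aj * => /= yB.
pose u := y *m S.
have uB j : y *m B j *m S = u *m (invmx S *m B j *m S).
  by rewrite /u !mulmxA mulmxK.
have uE : x ^+ p.*2.+2 *: u =
    \sum_(j < p) x ^+ j.*2 *: (u *m mx2 (v j.*2) (w j.*2) (v j.*2.+1) (w j.*2.+1))
    + x ^+ p.*2 *: (u *m mx2 alpha gamma 0 beta).
  rewrite {1}/u scalemxAl -[p.*2.+2]/(p.+1.*2) -yB mulmx_suml big_ord_recr /=.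
  congr (_ + _); last by rewrite -scalemxAl uB Ap.
  by apply: eq_bigr => j _; rewrite -scalemxAl uB -Aj.
have {}uE k : u 0 k * x ^+ p.*2.+2 = x ^+ p.*2 * (u *m mx2 alpha gamma 0 beta) 0 k +
    \sum_(j < p) x ^+ j.*2 *
      (u *m mx2 (v j.*2) (w j.*2) (v j.*2.+1) (w j.*2.+1)) 0 k.
  have /rowP/(_ k) := uE; rewrite [LHS]mxE mulrC => ->.
  rewrite mxE addrC summxE [X in X + _]mxE; congr (_ + _).
  by apply: eq_bigr => j _; rewrite [LHS]mxE.
exists (u 0 0), (u 0 1); split.
- apply/negP => /andP[/eqP u0 /eqP u1].
  have uz : u = 0.
    apply/rowP => k; rewrite [RHS]mxE.
    by case: k => [[|[|//]]] ?; [rewrite -[RHS]u0|rewrite -[RHS]u1];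
       congr (u _ _); apply: val_inj.
  have : y = 0 by rewrite -[y](mulmxK Su) -/u uz mul0mx.
  by move=> /rowP/(_ 0)/eqP; rewrite !mxE expr0 oner_eq0.
- rewrite uE (mul_row_mx2 _ _ _ _ _).1; congr (_ + _); first by ring.
  by apply: eq_bigr => j _; rewrite (mul_row_mx2 _ _ _ _ _).1.
- rewrite uE (mul_row_mx2 _ _ _ _ _).2; congr (_ + _); first by ring.
  by apply: eq_bigr => j _; rewrite (mul_row_mx2 _ _ _ _ _).2.
Qed.

Theorem theorem3p1 (R : realType) (l : nat) (b : nat -> R[i]) (z : 'I_l -> R[i])
    (S : 'M[R[i]]_2) (alpha beta gamma : R[i]) (v w : nat -> R[i]) :
  let m := half_deg l in
  let n := even_deg l in
  let A := A_block n (a_coef l b) in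
  (3 <= l)%N ->
  'X^l + \sum_(j < l) b j *: 'X^j = \prod_(j < l) ('X - (z j)%:P) ->
  S \in unitmx ->
  invmx S *m A m.-1 *m S = mx2 alpha gamma 0 beta ->
  (forall j, (j <= m - 2)%N ->
     mx2 (v j.*2) (w j.*2) (v j.*2.+1) (w j.*2.+1) = invmx S *m A j *m S) ->
  (exists r1 r2 : R,
     [/\ unique (pos_sol (psi1 n alpha v)) r1,
         unique (pos_sol (psi2 n beta gamma w)) r2
       & forall j : 'I_l, cmod (z j) <= Num.max r1 r2])
  /\
  (exists s1 s2 : R,
     [/\ unique (pos_sol (phi1 m alpha v)) s1,
         unique (pos_sol (phi2 m beta gamma w)) s2
       & forall j : 'I_l, cmod (z j) <= Num.sqrt (Num.max s1 s2)]).

Proof.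
move=> m n A l_ge3 pz Su Am Aj.
have l_gt0 : (0 < l)%N by apply: leq_trans l_ge3.
have [p mE] : exists p, m = p.+2.
  exists (m - 2)%N; rewrite -addn2 subnK// /m /half_deg.
  by rewrite (leq_trans (_ : 2 <= uphalf 3)%N)// uphalf_leq.
have hE : half_deg l = p.+2 := mE.
have nE : n = p.+1.*2.+2 by rewrite /n /even_deg hE.
(* The bound [j <= p] now in [Aj] computes to the [j < p.+1] expected by [block_coords]. *)
rewrite mE succnK in Am; rewrite mE subn2 /= in Aj.
have root_z j : z j ^+ l + \sum_(i < l) b i * z j ^+ i = 0.
  move/(congr1 (horner^~ (z j))): pz.
  rewrite hornerD hornerXn horner_sum horner_prod [X in _ = X -> _](bigD1 j)//= hornerXsubC subrr mul0r.
  move=> pz0; rewrite -[RHS]pz0.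
  by congr (_ + _); apply: eq_bigr => i _; rewrite hornerZ hornerXn.
have coords j := block_coords l_gt0 hE (root_z j) Su Am Aj.
have {coords} dom j : exists U V : R, [/\ 0 <= U, 0 <= V, (0 < U) || (0 < V),
    U * cmod (z j) ^+ p.+1.*2.+2 <= U * (cmod alpha * cmod (z j) ^+ p.+1.*2) +
       \sum_(i < p.+1) cmod (z j) ^+ i.*2 *
         (U * cmod (v i.*2) + V * cmod (v i.*2.+1))
  & V * cmod (z j) ^+ p.+1.*2.+2 <=
       (U * cmod gamma + V * cmod beta) * cmod (z j) ^+ p.+1.*2 +
       \sum_(i < p.+1) cmod (z j) ^+ i.*2 *
         (U * cmod (w i.*2) + V * cmod (w i.*2.+1))].
  have [u1 [u2 [u_neq0 /cmod_block_bound E1 /cmod_block_bound E2]]] := coords j.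
  exists (cmod u1), (cmod u2); split; rewrite ?cmod_ge0//.
  - rewrite !lt_def !cmod_ge0 !andbT -negb_and; apply: contra u_neq0.
    move=> /andP[/eqP/ComplexField.Normc.eq0_normc->].
    by move=> /eqP/ComplexField.Normc.eq0_normc->; rewrite eqxx.
  - by rewrite ComplexField.Normc.normcM -mulrA in E1.
  (* The second column of the triangular block has two entries, hence one more triangle
     inequality. *)
  - rewrite (le_trans E2)// lerD2r ler_wpM2r ?exprn_ge0 ?cmod_ge0//.
    by rewrite (le_trans (le_normcD _ _))// !ComplexField.Normc.normcM.
rewrite /psi1 /psi2 /phi1 /phi2 nE mE !subn1 subn2 addn1 /=.
have cge0 (c : nat -> R[i]) k : 0 <= cmod (c k) by exact: cmod_ge0.
have c2ge0 (c : nat -> R[i]) k : 0 <= cmod (c k.*2.+1) + cmod (c k.*2).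
  by rewrite addr_ge0 ?cmod_ge0.
have le2 k : (k <= k.+2)%N by rewrite -addn2 leq_addr.
split.

(* The bound by the roots of [psi1] and [psi2] *)
- have [|||r1 [r1_uniq r1_ge0 r1_max]] := @cauchy_sol R p.+1.*2.+2
    (cmod alpha) 0 p.+1.*2 0 (fun k => cmod (v k)) p.+1.*2 (cmod_ge0 _)
    (lexx _) (cge0 v);
    rewrite ?le2//.
  have [|||r2 [r2_uniq r2_ge0 r2_max]] := @cauchy_sol R p.+1.*2.+3
    (cmod beta) (cmod gamma) p.+1.*2.+1 p.+1.*2 (fun k => cmod (w k)) p.+1.*2
    (cmod_ge0 _) (cmod_ge0 _) (cge0 w);
    rewrite ?ltnS ?(leqW (le2 _)) ?le2//.
  rewrite scale0r subr0 in r1_uniq.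
  exists r1, r2; split=> // j.
  have [U [V [U_ge0 V_ge0 UV H1 H2]]] := dom j; rewrite le_max.
  set x := cmod (z j) in H1 H2 *; have x_ge0 : 0 <= x := cmod_ge0 _.
  (* If [V <= x * U], replacing [V] by [x * U] in [H1] turns the odd-indexed terms into odd powers
     of [x]; dividing by [U] gives the inequality for [psi1]. *)
  have [VU|UV'] := leP V (x * U).
    have U_gt0 : 0 < U.
      rewrite lt_def U_ge0 andbT; apply: contraTneq UV => U0.
      by rewrite U0 ltxx ltNge; move: VU; rewrite U0 mulr0 => ->.
    apply/orP; left; apply: r1_max => //.
    rewrite -(ler_pM2l U_gt0) (le_trans H1)// mul0r addr0 mulrDr lerD2l.
    rewrite (big_ord_double (fun k => cmod (v k) * x ^+ k)) mulr_sumr.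
    apply: ler_sum => i _; rewrite exprS -subr_ge0.
    rewrite [leRHS](_ : _ = x ^+ i.*2 * (cmod (v i.*2.+1) * (x * U - V))); last by ring.
    by rewrite mulr_ge0 ?exprn_ge0// mulr_ge0 ?cmod_ge0 ?subr_ge0.
  have V_gt0 : 0 < V by apply: le_lt_trans UV'; rewrite mulr_ge0.
  apply/orP; right; apply: r2_max => //.
  (* Multiplying [H2] by [x] makes each [U] appear as [x * U], which [V] dominates; this is why
     [psi2] has degree [n + 1]. *)
  rewrite -(ler_pM2l V_gt0) exprS mulrCA (le_trans (ler_wpM2l x_ge0 H2))//.
  rewrite mulrDr [leRHS]mulrDr lerD//.
    rewrite exprS -subr_ge0.
    rewrite [leRHS](_ : _ = x ^+ p.+1.*2 * (cmod gamma * (V - x * U))); last by ring.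
    by rewrite mulr_ge0 ?exprn_ge0// mulr_ge0 ?cmod_ge0 ?subr_ge0 ?(ltW UV').
  rewrite (big_ord_double (fun k => cmod (w k) * x ^+ k)) !mulr_sumr.
  apply: ler_sum => i _; rewrite exprS -subr_ge0.
  rewrite [leRHS](_ : _ = x ^+ i.*2 * (cmod (w i.*2) * (V - x * U))); last by ring.
  by rewrite mulr_ge0 ?exprn_ge0// mulr_ge0 ?cmod_ge0 ?subr_ge0 ?(ltW UV').

(* The bound by the roots of [phi1] and [phi2] *)
- have [|||s1 [s1_uniq s1_ge0 s1_max]] := @cauchy_sol R p.+2 (cmod alpha) 0
    p.+1 0 (fun k => cmod (v k.*2.+1) + cmod (v k.*2)) p.+1 (cmod_ge0 _) (lexx _) (c2ge0 v);
    rewrite ?leqnSn//.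
  have [||||s2 [s2_uniq s2_ge0 s2_max]] := @cauchy_sol R p.+2 (cmod beta + cmod gamma) 0
    p.+1 0 (fun k => cmod (w k.*2.+1) + cmod (w k.*2)) p.+1 _ (lexx _) (c2ge0 w);
    rewrite ?leqnSn ?addr_ge0 ?cmod_ge0//.
  rewrite !scale0r !subr0 in s1_uniq s2_uniq.
  exists s1, s2; split=> // j.
  have [U [V [U_ge0 V_ge0 UV H1 H2]]] := dom j.
  set x := cmod (z j) in H1 H2 *; have x_ge0 : 0 <= x := cmod_ge0 _.
  rewrite -[x]ger0_norm// -sqrtr_sqr ler_wsqrtr// le_max.
  have x2_ge0 : 0 <= x ^+ 2 by rewrite exprn_ge0.
  have x2E k : x ^+ k.*2 = (x ^+ 2) ^+ k by rewrite -exprM mul2n.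
  (* Only even powers of [x] occur, so [H1] and [H2] are inequalities in [x ^+ 2] of half the
     degree, and comparing [U] with [V] directly adds no factor [x]. *)
  rewrite -doubleS x2E (x2E p.+1) in H1 H2.
  have [VU|UV'] := leP V U.
    have U_gt0 : 0 < U.
      rewrite lt_def U_ge0 andbT; apply: contraTneq UV => U0.
      by rewrite U0 ltxx ltNge -U0 VU.
    apply/orP; left; apply: s1_max => //.
    rewrite -(ler_pM2l U_gt0) (le_trans H1)// mul0r addr0 mulrDr lerD2l mulr_sumr.
    apply: ler_sum => i _; rewrite x2E -subr_ge0.
    rewrite [leRHS](_ : _ = (x ^+ 2) ^+ i * (cmod (v i.*2.+1) * (U - V))); last by ring.
    by rewrite mulr_ge0 ?exprn_ge0// mulr_ge0 ?cmod_ge0 ?subr_ge0.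
  have V_gt0 : 0 < V by apply: le_lt_trans UV'.
  apply/orP; right; apply: s2_max => //.
  rewrite -(ler_pM2l V_gt0) (le_trans H2)// mul0r addr0 mulrDr lerD//.
    rewrite -subr_ge0.
    rewrite [leRHS](_ : _ = (x ^+ 2) ^+ p.+1 * (cmod gamma * (V - U))); last by ring.
    by rewrite mulr_ge0 ?exprn_ge0// mulr_ge0 ?cmod_ge0 ?subr_ge0 ?(ltW UV').
  rewrite mulr_sumr; apply: ler_sum => i _; rewrite x2E -subr_ge0.
  rewrite [leRHS](_ : _ = (x ^+ 2) ^+ i * (cmod (w i.*2) * (V - U))); last by ring.
  by rewrite mulr_ge0 ?exprn_ge0// mulr_ge0 ?cmod_ge0 ?subr_ge0 ?(ltW UV').
Qed.
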